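(* Let $F$ be a field of characteristic zero. For every $\alpha\in F\setminus\{0\}$, the algebra with trace $D_2^{t_{\alpha,\alpha}}$ generates a variety of almost polynomial growth.
   Context: $F$ is a field of characteristic 0. An algebra with trace is a unitary associative $F$-algebra $A$ with an $F$-linear map $\mathrm{tr}:A\to F$ such that $\mathrm{tr}(ab)=\mathrm{tr}(ba)$; a scalar is identified with the corresponding multiple of $1_A$. The free algebra with trace $F\langle X,\mathrm{Tr}\rangle\cong F\langle X\rangle\otimes F[\mathrm{Tr}(M)]$ on $X=\{x_1,x_2,\dots\}$ is generated by the free unitary associative algebra $F\langle X\rangle$ and central commuting indeterminates $\mathrm{Tr}(M)$, $M$ a nonempty word in $X$, subject to $\mathrm{Tr}(MN)=\mathrm{Tr}(NM)$ and $\mathrm{Tr}(\mathrm{Tr}(M)N)=\mathrm{Tr}(M)\mathrm{Tr}(N)$. An element is a trace identity of $A$ if it becomes $0$ whenever the variables are replaced by arbitrary elements of $A$ and $\mathrm{Tr}$ by $\mathrm{tr}$; $\mathrm{Id}^{tr}(A)$ is the set of trace identities of $A$. $MT_n$ is the space of multilinear elements of $F\langle X,\mathrm{Tr}\rangle$ in $x_1,\dots,x_n$ (the span of all products of traces of words times a word in which each of $x_1,\dots,x_n$ occurs exactly once in total), and $c_n^{tr}(A)=\dim_F MT_n/(MT_n\cap \mathrm{Id}^{tr}(A))$. The variety $\mathrm{var}^{tr}(A)$ is the class of all algebras with trace satisfying all trace identities of $A$. The growth of a variety is the growth of the sequence $c_n^{tr}(A)$ for any algebra with trace $A$ generating it: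 polynomial growth means bounded above by a polynomial in $n$, exponential growth means $c_n^{tr}(A)\ge C b^n$ for all $n\geq 1$, for some $C>0$, $b>1$. A variety has almost polynomial growth if it grows exponentially but every proper subvariety $\mathrm{var}^{tr}(A)$ of it has polynomial growth. $D_2$ is the algebra of $2\times 2$ diagonal matrices over $F$, and $D_2^{t_{\alpha,\alpha}}$ is $D_2$ with the trace $t_{\alpha,\alpha}(\mathrm{diag}(a,b))=\alpha(a+b)$. *)

(* Defs.v *)
From HB Require Import structures.
From mathcomp Require Import all_boot all_order all_algebra.
From mathcomp Require Import finmap monalg.
From mathcomp Require Import ring.
From mathcomp Require Import boolp classical_sets reals.

Set Implicit Arguments.
Unset Strict Implicit.
Unset Printing Implicit Defensive.

Import Order.TTheory GRing.Theory Num.Theory.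
Local Open Scope quotient_scope.
Local Open Scope classical_set_scope.
Local Open Scope ring_scope.

Record traceAlg (F : fieldType) := TraceAlg {
  talg :> algType F;
  tr : {scalar talg};
  trMC : forall x y : talg, tr (x * y) = tr (y * x)
}.
Arguments tr {F t}.
Arguments trMC {F t}.

(* Variables are indexed by nat: the letter i stands for x_(i+1). *)
Definition nword := {w : seq nat | w != [::]}.

(* [rotw u v] holds iff u = M ++ N and v = N ++ M for some M, N, so that
   [cword] indexes the symbols Tr(M) modulo Tr(MN) = Tr(NM). *)
Definition rotw : rel nword :=
  fun u v => [exists k : 'I_(size (val u)).+1, val v == rot k (val u)].

Lemma rotw_refl : reflexive rotw.
Proof. by move=> u; apply/existsP; exists ord0; rewrite rot0. Qed.

Lemma rotwE u v : rotw u v <-> exists k, val v = rot k (val u).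
Proof.
split=> [/existsP[k /eqP->]|[k uv]]; first by exists k.
apply/existsP; case: (leqP k (size (val u))) => ku.
  by exists (Ordinal (ku : k < (size (val u)).+1)%N); apply/eqP.
exists ord0; rewrite rot0 uv rot_oversize //; exact: ltnW.
Qed.

Lemma rotw_sym : symmetric rotw.
Proof.
suff h u v : rotw u v -> rotw v u by move=> u v; apply/idP/idP; exact: h.
move=> /rotwE[k uv]; apply/rotwE; exists (size (val v) - k)%N.
by rewrite -[LHS](rotK k) -uv.
Qed.

Lemma rotw_trans : transitive rotw.
Proof.
move=> v u w /rotwE[k uv] /rotwE[l vw]; apply/rotwE.
by eexists; rewrite vw uv rot_rot_add.
Qed.

Canonical rotw_equiv := EquivRel rotw rotw_refl rotw_sym rotw_trans.

Definition cword := {eq_quot rotw}.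
HB.instance Definition _ := Choice.on cword.

(* The monomial Tr(M_1) ... Tr(M_k) w, encoded as (Tr(M_1) ... Tr(M_k), w). *)
Definition trmon := ({cmonom cword} * {fmonom nat})%type.
HB.instance Definition _ := Choice.on trmon.

Definition trmon_one : trmon := (mone, mone).
Definition trmon_mul (k l : trmon) : trmon := (mmul k.1 l.1, mmul k.2 l.2).

Fact trmon_mulA : associative trmon_mul.
Proof. by move=> k l m; rewrite /trmon_mul !mulmA. Qed.

Fact trmon_mul1m : left_id trmon_one trmon_mul.
Proof. by case=> k l; rewrite /trmon_mul !mul1m. Qed.

Fact trmon_mulm1 : right_id trmon_one trmon_mul.
Proof. by case=> k l; rewrite /trmon_mul !mulm1. Qed.

Fact trmon_unitm k l :
  trmon_mul k l = trmon_one -> k = trmon_one /\ l = trmon_one.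
Proof.
by case: k l => [k1 k2] [l1 l2] [/unitm[-> ->] /unitm[-> ->]].
Qed.

HB.instance Definition _ := Choice_isMonomialDef.Build trmon
  trmon_mulA trmon_mul1m trmon_mulm1 trmon_unitm.

(* F<X> (x) F[Tr(M)], as the algebra of the monoid of trace monomials. Nested
   traces do not occur: Tr(Tr(M)N) = Tr(M)Tr(N) is already in normal form. *)
Definition trfree (F : fieldType) := {malg F[trmon]}.

Section Evaluation.
Variables (F : fieldType) (A : traceAlg F) (a : nat -> A).

Definition weval (w : seq nat) : A := \prod_(i <- w) a i.

(* By [tr_weval_repr], the choice of the representative of c is immaterial. *)
Definition mon_eval (k : trmon) : A :=
  (\prod_(c <- finsupp k.1) tr (weval (val (repr c))) ^+ k.1 c) *: weval k.2.

Definition treval (p : trfree F) : A := \sum_(k <- msupp p) p@_k *: mon_eval k.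

Lemma tr_weval_repr (w : nword) :
  tr (weval (val (repr (\pi_cword w)))) = tr (weval (val w)).
Proof.
have /eqmodP/rotwE[k ->] : repr (\pi_cword w) = w %[mod cword] by rewrite reprK.
rewrite /rot /weval big_cat /= trMC -big_cat /=.
by rewrite cat_take_drop.
Qed.

End Evaluation.

Section TraceIdentities.
Variable F : fieldType.

Definition trace_ids (A : traceAlg F) : set (trfree F) :=
  [set p | forall a : nat -> A, treval a p = 0].

(* Classes of algebras with trace; [set (traceAlg F)] is ruled out by universe
   constraints. *)
Definition trclass := traceAlg F -> Prop.

Definition trace_var (A : traceAlg F) : trclass :=
  fun B => trace_ids A `<=` trace_ids B.

Definition generates (A : traceAlg F) (V : trclass) : Prop :=
  forall B, trace_var A B <-> V B.

Definition proper_subclass (W V : trclass) : Prop :=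
  (forall B, W B -> V B) /\ (exists B, V B /\ ~ W B).

Definition occ (i : nat) (k : trmon) : nat :=
  \sum_(c <- finsupp k.1) k.1 c * count_mem i (val (repr c)) + count_mem i k.2.

Definition multilinear (n : nat) (k : trmon) : Prop :=
  forall i, occ i k = (i < n)%N :> nat.

(* The monomials form a basis, so the span of the multilinear ones is the set
   of polynomials supported on them. *)
Definition MT (n : nat) : set (trfree F) :=
  [set p | forall k, k \in msupp p -> multilinear n k].

(* For subspaces I `<=` M of V: the classes of the e_i form a basis of M / I. *)
Definition quot_basis (V : lmodType F) (M I : set V) d (e : 'I_d -> V) : Prop :=
  (forall i, M (e i)) /\
  (forall v, M v -> exists! c : 'rV[F]_d, I (v - \sum_i c 0 i *: e i)).

Definition quot_dim (V : lmodType F) (M I : set V) : nat :=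
  xget 0 [set d | exists e : 'I_d -> V, quot_basis M I e].

(* [codimP] and [codimE] below show that the default value 0 of [xget] is not
   used. *)
Definition codim (A : traceAlg F) (n : nat) : nat :=
  quot_dim (MT n) (MT n `&` trace_ids A).

End TraceIdentities.

Section Growth.
Variable R : realType.

Definition poly_growth (u : nat -> nat) : Prop :=
  exists p : {poly R}, forall n, (u n)%:R <= p.[n%:R].

Definition exp_growth (u : nat -> nat) : Prop :=
  exists C b : R,
    [/\ 0 < C, 1 < b & forall n, (1 <= n)%N -> C * b ^+ n <= (u n)%:R].

Definition almost_poly_growth (F : fieldType) (V : trclass F) : Prop :=
  (forall A, generates A V -> exp_growth (codim A)) /\
  (forall A, proper_subclass (trace_var A) V -> poly_growth (codim A)).

End Growth.

Section DiagonalMatrices.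
Variable F : fieldType.

Definition diag2_pred : {pred 'M[F]_2} := fun M => is_diag_mx M.

Fact diag2_closed : GRing.subsemialg_closed diag2_pred.
Proof.
split.
- exact: scalar_mx_is_diag.
- split=> [|A B /is_diag_mxP dA /is_diag_mxP dB]; first exact: mx0_is_diag.
  by apply/is_diag_mxP => i j ij; rewrite mxE dA // dB // addr0.
- move=> c A /is_diag_mxP dA.
  by apply/is_diag_mxP => i j ij; rewrite mxE dA // mulr0.
- move=> A B /is_diag_mxP dA /is_diag_mxP dB; apply/is_diag_mxP => i j ij.
  rewrite mxE big1 // => k _; have [ik|ik] := eqVneq (i : nat) k.
    by rewrite dB ?mulr0 // -ik.
  by rewrite dA ?mul0r.
Qed.

HB.instance Definition _ :=
  GRing.isSubalgClosed.Build F 'M[F]_2 diag2_pred diag2_closed.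

Record diag2 := Diag2 { diag2_val :> 'M[F]_2; _ : diag2_val \in diag2_pred }.

HB.instance Definition _ := [isSub for diag2_val].
HB.instance Definition _ := [Choice of diag2 by <:].
HB.instance Definition _ := [SubChoice_isSubAlgebra of diag2 by <:].

Definition diag2_tr (alpha : F) (x : diag2) : F :=
  alpha * (diag2_val x 0 0 + diag2_val x 1 1).

Fact diag2_tr_linear alpha : scalar (diag2_tr alpha).
Proof.
move=> c x y; rewrite /diag2_tr.
have -> : diag2_val (c *: x + y) = c *: diag2_val x + diag2_val y by [].
by rewrite !mxE; ring.
Qed.

HB.instance Definition _ alpha :=
  GRing.isLinear.Build F diag2 F *%R (diag2_tr alpha) (diag2_tr_linear alpha).

Fact diag2_trMC alpha (x y : diag2) :
  diag2_tr alpha (x * y) = diag2_tr alpha (y * x).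
Proof.
rewrite /diag2_tr.
have vM (u v : diag2) : diag2_val (u * v) = diag2_val u *m diag2_val v by [].
have sum2 (f : 'I_2 -> F) : \sum_i f i = f 0 + f 1.
  by rewrite big_ord_recl big_ord1; congr (_ + f _); apply: val_inj.
rewrite !vM !mxE !sum2; case: x y => [x /is_diag_mxP dx] [y /is_diag_mxP dy] /=.
by rewrite !(dx 0 1, dx 1 0, dy 0 1, dy 1 0) //; ring.
Qed.

Definition D2t (alpha : F) : traceAlg F := TraceAlg (@diag2_trMC alpha).

End DiagonalMatrices.

Section EvaluationTheory.
Variables (F : fieldType) (A : traceAlg F) (a : nat -> A).

Lemma trevalEw (d : {fset trmon}) (p : trfree F) : (msupp p `<=` d)%fset ->
  treval a p = \sum_(k <- d) p@_k *: mon_eval a k.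
Proof.
move=> le; rewrite /treval (big_fset_incl _ le) //= => k _ /mcoeff_outdom ->.
by rewrite scale0r.
Qed.

Lemma treval_linear : linear (treval a).
Proof.
move=> c p q; set d := (msupp (c *: p + q) `|` (msupp p `|` msupp q))%fset.
have dpq : (msupp (c *: p + q) `<=` d)%fset by exact: fsubsetUl.
have dp : (msupp p `<=` d)%fset by rewrite fsubsetU // fsubsetUl orbT.
have dq : (msupp q `<=` d)%fset by rewrite fsubsetU // fsubsetUr orbT.
rewrite (trevalEw dpq) (trevalEw dp) (trevalEw dq).
rewrite scaler_sumr -big_split /=; apply: eq_bigr => k _.
by rewrite mcoeffD mcoeffZ scalerDl -scalerA.
Qed.

HB.instance Definition _ :=
  GRing.isLinear.Build F (trfree F) A *:%R (treval a) treval_linear.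

End EvaluationTheory.

Section QuotientDimension.
Variables (F : fieldType) (V : lmodType F) (M I : set V).
Hypotheses (I0 : I 0) (IL : forall c u v, I u -> I v -> I (c *: u + v)).

Let comb d (e : 'I_d -> V) (c : 'rV[F]_d) := \sum_i c 0 i *: e i.

Let comb_linear d (e : 'I_d -> V) : linear (comb e).
Proof.
move=> a c c'; rewrite /comb scaler_sumr -big_split; apply: eq_bigr => i _.
by rewrite !mxE scalerDl scalerA.
Qed.

HB.instance Definition _ d e :=
  GRing.isLinear.Build F 'rV[F]_d V *:%R (@comb d e) (comb_linear e).

Let IZ c u : I u -> I (c *: u).
Proof. by move=> Iu; rewrite -[_ *: _]addr0; exact: IL. Qed.

Let ID u v : I u -> I v -> I (u + v).
Proof. by move=> Iu Iv; rewrite -[u]scale1r; exact: IL. Qed.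

Let IN u : I u -> I (- u).
Proof. by rewrite -scaleN1r; exact: IZ. Qed.

Let ISum (J : Type) (s : seq J) (f : J -> V) :
  (forall j, I (f j)) -> I (\sum_(j <- s) f j).
Proof. by move=> If; elim/big_ind: _. Qed.

Lemma quot_basis_ex (s : seq V) : (forall x, x \in s -> M x) ->
  exists d (e : 'I_d -> V), [/\ forall i, M (e i),
    forall c : 'rV[F]_d, I (\sum_i c 0 i *: e i) -> c = 0 &
    forall x, x \in s -> exists c : 'rV[F]_d, I (x - \sum_i c 0 i *: e i)].
Proof.
elim: s => [|x s IHs] sM.
  exists 0%N, (fun=> 0); split=> [[]//|c _|//]; by apply/rowP => -[].
have [y ys|d [e [eM ef es]]] := IHs; first by apply: sM; rewrite inE ys orbT.
have [[c Ic]|xNe] := pselect (exists c, I (x - comb e c)).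
  exists d, e; split=> // y; rewrite inE => /predU1P[->|/es//]; by exists c.
exists (1 + d)%N.
pose e' (i : 'I_(1 + d)) := if split i is inr j then e j else x.
have e'E (c : 'rV_(1 + d)) : comb e' c = c 0 0 *: x + comb e (rsubmx c).
  rewrite /comb big_split_ord /= big_ord1 /e'; congr (_ *: _ + _).
  - by congr (c 0 _); apply: val_inj.
  - by case: splitP => // j /= /eqP.
  - apply: eq_bigr => i _; rewrite mxE; case: splitP => [j|j /= /addnI/val_inj->//].
    by rewrite [j]ord1.
exists e'; split.
- by move=> i; rewrite /e'; case: (split i) => // _; exact: sM (mem_head _ _).
- move=> c; rewrite -/(comb e' c) e'E => Ic.
  have c0 : c 0 0 = 0.
    apply: contra_notP xNe => /eqP c0; exists (- (c 0 0)^-1 *: rsubmx c).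
    rewrite linearZ /= scaleNr opprK.
    by move: (IZ (c 0 0)^-1 Ic); rewrite scalerDr scalerA mulVf // scale1r.
  move: Ic; rewrite c0 scale0r add0r => /ef cr0.
  rewrite -[c]hsubmxK cr0 (_ : lsubmx c = 0) ?row_mx0 //.
  by apply/rowP => i; rewrite !mxE [i]ord1 -[RHS]c0; congr (c 0 _); apply: val_inj.
- move=> y; rewrite inE => /predU1P[->|/es[c Ic]].
    exists (row_mx 1 0); rewrite -/(comb e' _) e'E row_mxKr linear0 addr0.
    have -> : row_mx (1 : 'rV[F]_1) (0 : 'rV[F]_d) 0 0 = 1.
      rewrite (_ : 0 = lshift d 0 :> 'I_(1 + d)) ?row_mxEl ?mxE ?eqxx //.
      exact: val_inj.
    by rewrite scale1r subrr.
  exists (row_mx 0 c); rewrite -/(comb e' _) e'E row_mxKr.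
  have -> : row_mx (0 : 'rV[F]_1) c 0 0 = 0.
    by rewrite (_ : 0 = lshift d 0 :> 'I_(1 + d)) ?row_mxEl ?mxE //; exact: val_inj.
  by rewrite scale0r add0r.
Qed.

Lemma quot_basis_le d d' (e : 'I_d -> V) (e' : 'I_d' -> V) :
  quot_basis M I e -> quot_basis M I e' -> (d' <= d)%N.
Proof.
move=> [eM eB] [e'M e'B].
have /choice[P HP] j : exists c, I (e' j - comb e c).
  by have [c []] := eB _ (e'M j); exists c.
have /choice[Q HQ] i : exists c, I (e i - comb e' c).
  by have [c []] := e'B _ (eM i); exists c.
apply: (@mulmx1_min F d' d (\matrix_j P j) (\matrix_i Q i)).
apply/row_matrixP => j; rewrite row_mul rowK row1.
have [c [_ cU]] := e'B _ (e'M j).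
rewrite -(cU (delta_mx 0 j)).
  apply/esym/cU; rewrite -/(comb e' _).
  rewrite mulmx_sum_row [comb e' _]linear_sum /=.
  rewrite -[e' j](subrK (comb e (P j))) -addrA; apply: ID => //.
  rewrite {1}/comb -sumrB; apply: ISum => i.
  by rewrite rowK linearZ /= -scalerBr; exact: IZ.
rewrite (bigD1 j) //= big1 => [|i ij]; last by rewrite mxE eqxx (negPf ij) scale0r.
by rewrite mxE !eqxx scale1r addr0 subrr.
Qed.

Lemma quot_dimE d (e : 'I_d -> V) : quot_basis M I e -> quot_dim M I = d.
Proof.
move=> eB; apply: xget_unique; first by exists e.
move=> d' [e' e'B]; apply/eqP; rewrite eqn_leq.
by rewrite (quot_basis_le eB e'B) (quot_basis_le e'B eB).
Qed.

End QuotientDimension.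

Section Codimension.
Variable F : fieldType.

Lemma trace_ids_linear (A : traceAlg F) c (p q : trfree F) :
  trace_ids A p -> trace_ids A q -> trace_ids A (c *: p + q).
Proof. by move=> p0 q0 a; rewrite linearP /= p0 q0 scaler0 addr0. Qed.

Lemma trace_ids0 (A : traceAlg F) : trace_ids A 0.
Proof. by move=> a; rewrite linear0. Qed.

Lemma MT_linear n c (p q : trfree F) : MT n p -> MT n q -> MT n (c *: p + q).
Proof.
move=> Mp Mq k; rewrite -mcoeff_neq0 mcoeffD mcoeffZ => cpq.
have [kp|kp] := boolP (k \in msupp p); first exact: Mp.
apply: Mq; rewrite -mcoeff_neq0; apply: contraNneq cpq => ->.
by rewrite (mcoeff_outdom kp) mulr0 addr0.
Qed.

Lemma MT0 n : MT n (0 : trfree F).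
Proof. by move=> k; rewrite msupp0 in_fset0. Qed.

Lemma multilinear_count n k c :
  multilinear n k -> c \in finsupp k.1 ->
  k.1 c = 1%N /\ forall i, (count_mem i (val (repr c)) <= (i < n))%N.
Proof.
move=> kn kc.
have le i : (k.1 c * count_mem i (val (repr c)) <= (i < n))%N.
  by rewrite -(kn i) /occ (big_fsetD1 c) //= -addnA leq_addr.
have c_gt0 : (0 < k.1 c)%N by rewrite lt0n cmE_neq0.
split=> [|i]; last by apply: leq_trans (le i); rewrite leq_pmull.
apply/eqP; rewrite eqn_leq c_gt0 andbT.
case: (val (repr c)) (valP (repr c)) le => //= x w _ /(_ x) le.
apply: leq_trans (leq_b1 (x < n)%N); apply: leq_trans le.
by rewrite eqxx leq_pmulr.
Qed.

Let words n m : seq (seq nat) :=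
  iter m (fun s => [::] :: [seq i :: w | i <- iota 0 n, w <- s]) [:: [::]].

Let mem_words n m w :
  (size w <= m)%N -> (forall i, i \in w -> (i < n)%N) -> w \in words n m.
Proof.
elim: m w => [|m IHm] [|i w] //= wm wn; rewrite inE //=.
apply/allpairsP; exists (i, w); split=> //=.
  by rewrite mem_iota wn ?mem_head.
by apply: IHm => // j jw; rewrite wn // inE jw orbT.
Qed.

Let words_count n w :
  (forall i, (count_mem i w <= (i < n))%N) -> w \in words n n.
Proof.
move=> wn; have w_lt i : i \in w -> (i < n)%N.
  by rewrite -has_pred1 has_count => /leq_trans/(_ (wn i)); case: (i < n)%N.
have uw : uniq w.
  apply: count_mem_uniq => i; have [iw|/count_memPn//] := boolP (i \in w).
  apply/eqP; rewrite eqn_leq (leq_trans (wn i) (leq_b1 _)).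
  by rewrite -has_count has_pred1.
apply: mem_words => //; rewrite -(size_iota 0 n); apply: uniq_leq_size => // i.
by rewrite mem_iota => /w_lt.
Qed.

Lemma multilinear_finite n :
  exists s : seq trmon, forall k, multilinear n k -> k \in s.
Proof.
pose C := [fset c : cword in pmap
  (fun w => omap (fun u : nword => \pi_cword u) (insub w)) (words n n)]%fset.
pose mon (B : {fset cword}) : {cmonom cword} := [cmonom 1 | _ in B]%M.
pose fmon (w : seq nat) : {fmonom nat} := FMonom w.
exists [seq (mon B, fmon w) | B <- fpowerset C, w <- words n n].
move=> k kn; apply/allpairsP; exists (finsupp k.1, fmonom_val k.2); split=> /=.
- rewrite fpowersetE; apply/fsubsetP => c kc; rewrite inE /= mem_pmap.
  have [_ cn] := multilinear_count kn kc.
  apply/mapP; exists (val (repr c)); first exact: words_count.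
  by rewrite insubT ?(valP (repr c)) // => ? /=; rewrite (_ : Sub _ _ = repr c) ?reprK //; exact: val_inj.
- by apply: words_count => i; rewrite -(kn i) leq_addl.
- case: k kn => [m [w]] kn /=; congr (_, _); apply/eqP/cmP => c.
  rewrite /mon cmE fsfun_fun; case: ifPn => [mc|]; last by rewrite -cmE_eq0 => /eqP.
  by have [] := multilinear_count kn mc.
Qed.

Lemma codimP (A : traceAlg F) n : exists e : 'I_(codim A n) -> trfree F,
  quot_basis (MT n) (MT n `&` trace_ids A) e.
Proof.
have I0 : (MT n `&` trace_ids A) (0 : trfree F).
  by split; [exact: MT0|exact: trace_ids0].
have IL c (p q : trfree F) : (MT n `&` trace_ids A) p ->
    (MT n `&` trace_ids A) q -> (MT n `&` trace_ids A) (c *: p + q).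
  by move=> [? ?] [? ?]; split; [exact: MT_linear|exact: trace_ids_linear].
have [s sP] := multilinear_finite n.
pose s' := [seq << k >> : trfree F | k <- s & `[< multilinear n k >]].
have s'M x : x \in s' -> MT n x.
  move=> /mapP[k]; rewrite mem_filter => /andP[/asboolP kn _] -> l.
  by rewrite msuppU oner_eq0 in_fset1 => /eqP->.
have [d [e [eM ef es]]] := quot_basis_ex I0 IL s'M.
have eB : quot_basis (MT n) (MT n `&` trace_ids A) e.
  split=> // p Mp.
  have [c Ic] : exists c : 'rV[F]_d,
      (MT n `&` trace_ids A) (p - \sum_i c 0 i *: e i).
    have /choice[f Hf] (k : trmon) : exists c : 'rV[F]_d, k \in msupp p ->
        (MT n `&` trace_ids A) (<< k >> - \sum_i c 0 i *: e i).
      have [kp|] := boolP (k \in msupp p); last by exists 0.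
      have [|c Ic] := es << k >>; last by exists c.
      apply: map_f; rewrite mem_filter sP ?andbT; last exact: Mp.
      by apply/asboolP/Mp.
    exists (\sum_(k <- msupp p) p@_k *: f k).
    have -> : p - \sum_i (\sum_(k <- msupp p) p@_k *: f k) 0 i *: e i =
        \sum_(k <- msupp p) p@_k *: (<< k >> - \sum_i f k 0 i *: e i).
      transitivity (\sum_(k <- msupp p) p@_k *: (<< k >> : trfree F) -
          \sum_(k <- msupp p) \sum_i (p@_k * f k 0 i) *: e i).
        congr (_ - _).
          rewrite {1}[p]monalgE; apply: eq_bigr => k _.
          by apply/malgP => l; rewrite mcoeffZ !mcoeffU mulr_natr.
        rewrite exchange_big /=; apply: eq_bigr => i _.
        by rewrite summxE scaler_suml; apply: eq_bigr => k _; rewrite mxE.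
      rewrite -sumrB; apply: eq_bigr => k _.
      rewrite scalerBr scaler_sumr; congr (_ - _).
      by apply: eq_bigr => i _; rewrite scalerA.
    rewrite big_seq; elim/big_ind: _ => // [x y Ix Iy|k kp].
      by rewrite -[x]scale1r; exact: IL.
    by rewrite -[_ *: _]addr0; apply: IL => //; exact: Hf.
  exists c; split=> // c' Ic'; apply/eqP; rewrite -subr_eq0; apply/eqP/ef.
  have := IL (-1) _ _ Ic Ic'; rewrite scaleN1r opprB addrA subrK -sumrB.
  by congr (_ _); apply: eq_bigr => i _; rewrite !mxE scalerBl.
by rewrite /codim (quot_dimE I0 IL eB); exists e.
Qed.

Lemma codimE (A : traceAlg F) n d (e : 'I_d -> trfree F) :
  quot_basis (MT n) (MT n `&` trace_ids A) e -> codim A n = d.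
Proof.
apply: quot_dimE => [|c p q [? ?] [? ?]].
  by split; [exact: MT0|exact: trace_ids0].
by split; [exact: MT_linear|exact: trace_ids_linear].
Qed.

End Codimension.

(* Main.v *)
From HB Require Import structures.
Require Import Defs.
From mathcomp Require Import all_boot all_order all_algebra reals.
From mathcomp Require Import finmap monalg boolp classical_sets ring.

(** Let D be D_2 with the trace alpha(a + b).

    Exponential growth. Let m_S be the product of Tr(x_i), for i outside S, times
    the word of the x_i, for i in S, where S is a subset of {1..n}. Substitute
    diag(1, -1), of trace 0, for the variables in T and diag(0, 1/alpha), of
    trace 1, for the others: the first diagonal entry of m_S becomes 1 if S = T
    and 0 otherwise. Hence the 2^n elements m_S are independent modulo the
    identities of D ([codim_D2_ge]). An algebra generating the variety of D has
    exactly the identities of D, so the bound holds for it too.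

    Proper subvarieties. As traces are scalars, an algebra B of the variety can
    be analysed directly, from a single consequence of the Cayley-Hamilton
    theorem ([polar_CH_D2]): with t = tr / alpha,
      2xy - t(x) y - t(y) x + t(x) t(y) - t(xy) = 0.
    - Putting y = 1 gives (2 - t(1)) (x - t(x)) = 0, so that every element of B
      is scalar unless t(1) = 2.
    - If t(1) = 2 and some z of trace 0 has z^2 = c <> 0, then all identities of
      B hold in D ([trace_ids_sub_D2]). Over a quadratic extension this is
      because 1 and z span a copy of D; here it is obtained over F by observing
      that the value of a trace polynomial at the elements p_i + q_i z is
      P(e) + Q(e) z, where the polynomials P and Q depend on p and q only, and
      z^2 = e ([treval_quadratic]). Scaling z gives infinitely many values of e
      at which P and Q vanish, whence P = Q = 0; the value e = 1 is the one of
      D, with z = diag(1, -1).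
    - Otherwise every z of trace 0 has z^2 = 0, and by the identity above the
      product of any two elements of trace 0 is 0.
    Thus, when B has an identity which is not one of D, there is a linear form l
    such that the elements x - l(x) have trace 0 and pairwise product 0. A
    multilinear expression in x_1, ..., x_n is then, on B, a combination of the
    product of all the l(x_i) and of the n expressions in which one factor l(x_j)
    is replaced by x_j - l(x_j); so the codimension is at most n + 1
    ([codim_square_zero]). *)

Set Implicit Arguments.
Unset Strict Implicit.
Unset Printing Implicit Defensive.

Import Order.TTheory GRing.Theory Num.Theory.
Local Open Scope ring_scope.

(** * Trace monomials as lists of words *)

(** The values and the degrees of trace monomials are iterated operators over the
    support of a commutative monomial; this makes them morphisms. *)
Lemma big_cmonomM (R : Type) (idx : R) (op : Monoid.com_law idx)
    (h : cword -> nat -> R) (k l : {cmonom cword}) :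
  (forall c, h c 0%N = idx) ->
  (forall c, {morph h c : m n / (m + n)%N >-> op m n}) ->
  \big[op/idx]_(c <- finsupp (mmul k l)) h c (mmul k l c) =
  op (\big[op/idx]_(c <- finsupp k) h c (k c))
     (\big[op/idx]_(c <- finsupp l) h c (l c)).
Proof.
move=> h0 hD; set d := (finsupp k `|` finsupp l)%fset.
have widen (m : {cmonom cword}) : (finsupp m `<=` d)%fset ->
    \big[op/idx]_(c <- finsupp m) h c (m c) = \big[op/idx]_(c <- d) h c (m c).
  move=> md; apply: big_fset_incl => // c _; rewrite -cmE_eq0 => /eqP ->.
  exact: h0.
rewrite !widen ?fsubsetUl ?fsubsetUr ?mdomD ?fsubset_refl //.
by rewrite -big_split /=; apply: eq_bigr => c _; rewrite cmM hD.
Qed.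

Lemma big_cmonomU (R : Type) (idx : R) (op : Monoid.com_law idx)
    (h : cword -> nat -> R) c :
  \big[op/idx]_(d <- finsupp (ucm c)) h d (ucm c d) = h c 1%N.
Proof. by rewrite mdomU big_seq_fset1 cmUU. Qed.

(** The monomial Tr(u_1) ... Tr(u_k) w, given by words rather than by cyclic
    words with multiplicities, so that induction on lists applies. *)
Definition trmon_of (s : seq nword) (w : seq nat) : trmon :=
  (foldr (fun u m => mmul (ucm (\pi_cword u)%qT) m) mone s, FMonom w).

Lemma mon_eval_trmon_of (F : fieldType) (A : traceAlg F) (a : nat -> A) s w :
  mon_eval a (trmon_of s w) =
  (\prod_(u <- s) tr (weval a (val u))) *: weval a w.
Proof.
rewrite /mon_eval /=; congr (_ *: _).
pose h (c : cword) n := tr (weval a (val (repr c))) ^+ n.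
elim: s => [|u s IHs] /=; first by rewrite mdom1 big_seq_fset0 big_nil.
rewrite (@big_cmonomM _ _ _ h) /h //; last by move=> c m n; rewrite exprD.
by rewrite (@big_cmonomU _ _ _ h) /h IHs big_cons expr1 tr_weval_repr.
Qed.

Lemma occ_trmon_of i s w :
  occ i (trmon_of s w) = count_mem i (flatten (map val s) ++ w).
Proof.
rewrite /occ count_cat; congr (_ + _)%N.
pose h (c : cword) n := (n * count_mem i (val (repr c)))%N.
elim: s => [|u s IHs] /=; first by rewrite mdom1 big_seq_fset0.
rewrite (@big_cmonomM _ _ _ h) /h //; last by move=> c m n; rewrite /= mulnDl.
rewrite (@big_cmonomU _ _ _ h) /h /= IHs count_cat mul1n; congr (_ + _)%N.
have /eqmodP/rotwE[k ->] : (repr (\pi_cword u) = u %[mod cword])%qT.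
  by rewrite reprK.
by apply/esym/permP; rewrite perm_rot.
Qed.

Lemma trmon_ofP (k : trmon) : exists s, k = trmon_of s k.2.
Proof.
case: k => m w; pose s := flatten [seq nseq (m c) (repr c) | c <- finsupp m].
exists s; rewrite /trmon_of /= fmK; congr (_, _); apply/eqP/cmP => c.
have cE (r : seq nword) :
    foldr (fun u m => mmul (ucm (\pi_cword u)%qT) m) mone r c =
    count (fun u => \pi_cword u == c)%qT r.
  by elim: r => [|u r IHr] /=; rewrite ?cm1 // cmM cmU IHr.
rewrite cE count_flatten -map_comp sumnE big_map.
have cN d : count (fun u => \pi_cword u == c)%qT (nseq (m d) (repr d)) =
    ((d == c) * m d)%N by rewrite count_nseq /= reprK.
under eq_bigr do rewrite /= cN.
have [cm|] := boolP (c \in finsupp m).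
  rewrite (big_fsetD1 c) //= eqxx mul1n big_seq big1 ?addn0 // => d.
  by rewrite !inE => /andP[/negPf -> _].
move=> cm; rewrite big_seq big1 => [|d dm].
  by move: cm; rewrite -cmE_eq0 => /eqP.
by case: eqP dm cm => // -> ->.
Qed.

Lemma multilinear_trmon_of n s w :
  multilinear n (trmon_of s w) <->
  perm_eq (flatten (map val s) ++ w) (iota 0 n).
Proof.
have cI i : count_mem i (iota 0 n) = (i < n)%N.
  by rewrite count_uniq_mem ?iota_uniq // mem_iota.
split=> [sw|/permP sw i]; last by rewrite occ_trmon_of sw cI.
by apply/allP => i _; apply/eqP; rewrite -occ_trmon_of sw cI.
Qed.

(** * Linear algebra bounds on codimensions *)

Lemma treval_mon (F : fieldType) (A : traceAlg F) (a : nat -> A) k :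
  treval a << k >> = mon_eval a k.
Proof.
by rewrite /treval msuppU oner_eq0 big_seq_fset1 mcoeffUU scale1r.
Qed.

(** The coordinates of the f i in a basis of the quotient, multiplied by the
    values of the basis at the points b j, give the identity matrix; so its rank
    N is at most the number of elements of the basis. *)
Lemma codim_ge (F : fieldType) (A : traceAlg F) n N
    (f : 'I_N -> trfree F) (b : 'I_N -> nat -> A) (h : {scalar A}) :
  (forall i, MT n (f i)) ->
  (forall i j, h (treval (b j) (f i)) = (i == j)%:R) ->
  (N <= codim A n)%N.
Proof.
move=> fM hf; have [e [eM eB]] := codimP A n.
have /choice[c cP] i : exists c : 'rV_(codim A n),
    (MT n `&` trace_ids A)%classic (f i - \sum_j c 0 j *: e j).
  by have [c []] := eB _ (fM i); exists c.
apply: (@mulmx1_min F _ _ (\matrix_i c i)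
  (\matrix_(k, j) h (treval (b j) (e k)))).
apply/matrixP => i j; rewrite !mxE -(hf i j).
have [_ /(_ (b j)) /eqP] := cP i.
rewrite linearB subr_eq0 => /eqP ->.
rewrite (linear_sum (treval (b j))) linear_sum.
by apply: eq_bigr => k _; rewrite !mxE !linearZ_LR.
Qed.

(** A basis of the quotient has more elements than the g j only if some
    nontrivial combination of it has all coordinates 0 on the g j; such a
    combination is an identity, against independence. *)
Lemma codim_le (F : fieldType) (A : traceAlg F) n m
    (g : (nat -> A) -> 'I_m -> A) :
  (forall k, multilinear n k -> exists c : 'rV[F]_m,
     forall a, mon_eval a k = \sum_j c 0 j *: g a j) ->
  (codim A n <= m)%N.
Proof.
move=> kg; have [e [eM eB]] := codimP A n.
have /choice[C CP] i : exists c : 'rV[F]_m,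
    forall a, treval a (e i) = \sum_j c 0 j *: g a j.
  have /choice[d dP] (k : trmon) : exists c : 'rV[F]_m, multilinear n k ->
      forall a, mon_eval a k = \sum_j c 0 j *: g a j.
    have [/kg[c cP]|nk] := pselect (multilinear n k); first by exists c.
    by exists 0.
  exists (\sum_(k <- msupp (e i)) (e i)@_k *: d k) => a.
  rewrite /treval big_seq.
  under eq_bigr => k ki do rewrite (dP k (eM i k ki)) scaler_sumr.
  rewrite -big_seq exchange_big; apply: eq_bigr => j _.
  rewrite summxE scaler_suml; apply: eq_bigr => k _.
  by rewrite mxE scalerA.
have /eqP <- : row_free (\matrix_i C i); last exact: rank_leq_col.
apply: inj_row_free => v vC; have [|c [_ cU]] := eB 0; first exact: MT0.
set I := (MT n `&` trace_ids A)%classic in cU.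
have I0 : I 0 by split; [exact: MT0|exact: trace_ids0].
have vI : I (\sum_i v 0 i *: e i).
  split=> [|a].
    elim/big_ind: _ => [|p q Mp Mq|i _]; first exact: MT0.
      by rewrite -[p]scale1r; exact: MT_linear.
    by rewrite -[X in _ X]addr0; apply: MT_linear; [exact: eM|exact: MT0].
  rewrite (linear_sum (treval a)).
  under eq_bigr do rewrite linearZ_LR /= CP scaler_sumr.
  rewrite exchange_big big1 //= => j _.
  have vCj : \sum_i v 0 i * C i 0 j = 0.
    have /rowP/(_ j) := vC; rewrite [LHS]mxE [RHS]mxE => {2}<-.
    by under [RHS]eq_bigr do rewrite mxE.
  rewrite -[RHS](scale0r (g a j)) -vCj scaler_suml.
  by apply: eq_bigr => i _; rewrite scalerA.
have /cU <- : I (0 - \sum_i v 0 i *: e i).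
  rewrite sub0r -scaleN1r -[X in I X]addr0.
  case: vI I0 => [Mv Tv] [M0 T0].
  by split; [exact: MT_linear|exact: trace_ids_linear].
apply: cU; rewrite big1 ?subr0 // => i _.
by rewrite mxE scale0r.
Qed.

(** * Algebras that are square-zero modulo a linear form *)

(** When a i = l (a i) + y_i and the y_i have pairwise product 0, the product of
    the a i has no terms beyond those of degree 1 in the y_i. *)
Lemma weval_square_zero (F : fieldType) (A : traceAlg F) (l : A -> F)
    (a : nat -> A) w :
  (forall x y, (x - (l x)%:A) * (y - (l y)%:A) = 0) -> uniq w ->
  weval a w = (\prod_(i <- w) l (a i))%:A +
    \sum_(j <- w) (\prod_(i <- w | i != j) l (a i)) *: (a j - (l (a j))%:A).
Proof.
move=> y0; elim: w => [|x w IHw] /=.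
  by rewrite /weval !big_nil addr0 scale1r.
move=> /andP[xw uw]; rewrite /weval !big_cons -/(weval a w) IHw // eqxx /=.
set y := fun i => a i - (l (a i))%:A.
have aE i : a i = (l (a i))%:A + y i by rewrite /y addrC subrK.
set S := \sum_(j <- w) _.
have yS : y x * S = 0.
  by rewrite mulr_sumr big1 // => j _; rewrite -scalerAr y0 scaler0.
rewrite {1}(aE x) mulrDl -scalerAl mul1r scalerDr scalerA -addrA.
rewrite mulrDr yS addr0 -scalerAr mulr1 [_ *: S + _]addrC scaler_sumr.
congr (_ + (_ *: _ + _)).
  rewrite big_seq [RHS]big_seq_cond; apply: eq_bigl => i.
  by case: (boolP (i \in w)) => //= iw; apply/esym/(memPn xw).
rewrite big_seq [RHS]big_seq; apply: eq_bigr => j jw.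
by rewrite big_cons eq_sym (memPn xw) // scalerA.
Qed.

(** The trace of a word w only sees the scalar term of [weval_square_zero], so a
    multilinear monomial takes the value of a combination of n + 1 functions of
    the arguments: all factors l (a i), or all but one of them. *)
Lemma codim_square_zero (F : fieldType) (A : traceAlg F) (l : A -> F) n :
  (forall x, tr (x - (l x)%:A) = 0) ->
  (forall x y, (x - (l x)%:A) * (y - (l y)%:A) = 0) ->
  (codim A n <= n.+1)%N.
Proof.
move=> tr0 y0; pose y (x : A) := x - (l x)%:A.
(* For j = n no factor is omitted: this is the scalar term. *)
pose g (a : nat -> A) (j : nat) :=
  (\prod_(i <- iota 0 n | i != j) l (a i)) *:
  (if (j < n)%N then y (a j) else 1).
apply: (@codim_le _ _ _ n.+1 (fun a j => g a j)) => k.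
have [s ->] := trmon_ofP k.
move: {k}(fmonom_val k.2) => w /multilinear_trmon_of sw.
have := iota_uniq 0 n; rewrite -(perm_uniq sw) cat_uniq => /and3P[us sNw uw].
exists (\row_j (tr (1 : A) ^+ size s *+ ((j == n :> nat) || (val j \in w)))).
move=> a.
have trE u : uniq u -> tr (weval a u) = tr (1 : A) * \prod_(i <- u) l (a i).
  move=> uu; rewrite (weval_square_zero _ y0) // linearD linear_sum.
  rewrite [X in _ + X]big1.
    by rewrite addr0 linearZ_LR /= mulrC.
  by move=> j _; rewrite linearZ_LR /= tr0 mulr0.
have sE : \prod_(u <- s) tr (weval a (val u)) =
    tr (1 : A) ^+ size s * \prod_(i <- flatten (map val s)) l (a i).
  elim: s us {sw sNw} => [|u s IHs] /=; first by rewrite !big_nil mulr1.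
  rewrite cat_uniq => /and3P[uu _ us].
  by rewrite big_cons big_cat IHs // trE // exprS mulrACA.
rewrite mon_eval_trmon_of sE -scalerA; set t := tr 1 ^+ _.
have nw j : j \in w -> (j < n)%N.
  move=> jw; have : j \in iota 0 n by rewrite -(perm_mem sw) mem_cat jw orbT.
  by rewrite mem_iota.
have -> : \sum_j
      (\row_(j < n.+1) (t *+ ((j == n :> nat) || (val j \in w)))) 0 j *: g a j =
    t *: (g a n + \sum_(j < n.+1 | val j \in w) g a j).
  rewrite [X in _ *: (_ + X)]big_mkcond [LHS](bigD1 ord_max) //=.
  rewrite [X in _ *: (_ + X)](bigD1 ord_max) //=.
  rewrite !mxE eqxx /= ifN ?add0r; last by apply/negP => /nw; rewrite ltnn.
  rewrite scalerDr scaler_sumr; congr (_ + _); apply: eq_bigr => j jn.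
  rewrite mxE -val_eqE /= in jn *; rewrite (negPf jn) /=.
  by case: ifP => _; rewrite ?scaler0 ?scale0r.
congr (_ *: _); rewrite (weval_square_zero _ y0) // scalerDr; congr (_ + _).
  rewrite /g /= ltnn scalerA -big_cat (perm_big _ sw) /= big_seq.
  rewrite [X in _ = X *: _]big_seq_cond; congr (_ *: _); apply: eq_bigl => i.
  by rewrite mem_iota /=; case: ltngtP.
have -> : \sum_(j < n.+1 | val j \in w) g a j = \sum_(j <- w) g a j.
  rewrite -(big_mkord (fun j => j \in w)) -big_filter; apply: perm_big.
  apply: uniq_perm => [|//|j]; first by rewrite filter_uniq // iota_uniq.
  rewrite mem_filter mem_iota /=; case: (boolP (j \in w)) => //= /nw.
  by rewrite subn0 add0n ltnS => /ltnW.
rewrite scaler_sumr big_seq [RHS]big_seq; apply: eq_bigr => j jw.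
rewrite /g (nw _ jw) scalerA.
congr (_ *: _); rewrite -(perm_big _ sw) big_cat /=; congr (_ * _).
rewrite big_seq [RHS]big_seq_cond; apply: eq_bigl => i.
case: (boolP (i \in _)) => //= iS; apply/esym; apply: contraNneq sNw => ij.
by apply/hasP; exists j => //; rewrite -ij.
Qed.

(** * Evaluation in quadratic algebras *)

(** The subspace spanned by 1 and z is closed under products, and traces on it
    depend on tau only. Uniformity in C, z and e is what permits the transfer of
    identities from one algebra to another. *)
Lemma treval_quadratic (F : fieldType) (tau : F) (p q : nat -> F)
    (f : trfree F) :
  exists P Q : {poly F}, forall (C : traceAlg F) (z : C) (e : F),
    z * z = e%:A -> tr z = 0 -> tr (1 : C) = tau ->
    treval (fun i => (p i)%:A + q i *: z) f = (P.[e])%:A + Q.[e] *: z.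
Proof.
have wP (w : seq nat) : exists PQ : {poly F} * {poly F},
    forall (C : traceAlg F) (z : C) (e : F), z * z = e%:A ->
    weval (fun i => (p i)%:A + q i *: z) w = (PQ.1.[e])%:A + PQ.2.[e] *: z.
  elim: w => [|i w [[P Q] IHw]].
    exists (1, 0) => C z e _.
    by rewrite /weval big_nil /= hornerC horner0 scale0r addr0 scale1r.
  exists ((p i)%:P * P + (q i)%:P * Q * 'X, (p i)%:P * Q + (q i)%:P * P).
  move=> C z e zz; rewrite /weval big_cons -/(weval _ w) (IHw C z e) //=.
  rewrite !hornerE mulrDl !mulrDr -!scalerAl -!scalerAr !mul1r mulr1 zz.
  rewrite !scalerA !scalerDl -!addrA; congr (_ + _).
  by rewrite addrA addrC.
have kP (k : trmon) : exists PQ : {poly F} * {poly F},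
    forall (C : traceAlg F) (z : C) (e : F),
    z * z = e%:A -> tr z = 0 -> tr (1 : C) = tau ->
    mon_eval (fun i => (p i)%:A + q i *: z) k = (PQ.1.[e])%:A + PQ.2.[e] *: z.
  have [s ->] := trmon_ofP k; have [[P Q] PQ] := wP k.2.
  have [T TP] : exists T : {poly F}, forall (C : traceAlg F) (z : C) (e : F),
      z * z = e%:A -> tr z = 0 -> tr (1 : C) = tau ->
      \prod_(u <- s) tr (weval (fun i => (p i)%:A + q i *: z) (val u)) = T.[e].
    elim: s => [|u s [T IHs]].
      by exists 1 => C z e _ _ _; rewrite big_nil hornerC.
    have [[P' Q'] PQ'] := wP (val u).
    exists (P' * tau%:P * T) => C z e zz z0 t1.
    rewrite big_cons (IHs C z e) // (PQ' C z e) // linearD !linearZ /= z0 t1.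
    by rewrite mulr0 addr0 !hornerE.
  exists (T * P, T * Q) => C z e zz z0 t1.
  rewrite mon_eval_trmon_of (TP C z e) // (PQ C z e) //= !hornerE.
  by rewrite scalerDr !scalerA.
have /choice[g gP] := kP.
exists (\sum_(k <- msupp f) f@_k *: (g k).1),
  (\sum_(k <- msupp f) f@_k *: (g k).2).
move=> C z e zz z0 t1; rewrite /treval !horner_sum !scaler_suml -big_split /=.
by apply: eq_bigr => k _; rewrite (gP k C z e) // !hornerZ scalerDr !scalerA.
Qed.

(** * The algebra of diagonal matrices *)

Section Diagonal.
Variable F : fieldType.

Definition diag2_coord (i : 'I_2) (x : diag2 F) : F := diag2_val x i i.

Fact diag2_coord_linear i : scalar (diag2_coord i).
Proof.
move=> c x y; rewrite /diag2_coord.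
have -> : diag2_val (c *: x + y) = c *: diag2_val x + diag2_val y by [].
by rewrite !mxE.
Qed.

HB.instance Definition _ i :=
  GRing.isLinear.Build F (diag2 F) F *%R (diag2_coord i) (diag2_coord_linear i).

Fact diag2_coord_monoid i : monoid_morphism (diag2_coord i).
Proof.
split=> [|x y]; rewrite /diag2_coord.
  by rewrite (_ : diag2_val 1 = 1%:M) // mxE eqxx.
have -> : diag2_val (x * y) = diag2_val x *m diag2_val y by [].
case: x y => [x /is_diag_mxP dx] [y dy] /=.
rewrite mxE (bigD1 i) //= big1 ?addr0 // => k ki.
by rewrite dx ?mul0r // eq_sym.
Qed.

HB.instance Definition _ i :=
  GRing.isMonoidMorphism.Build (diag2 F) F (diag2_coord i)
    (diag2_coord_monoid i).

Lemma diag2_trE (alpha : F) (x : D2t alpha) :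
  tr x = alpha * (diag2_coord 0 x + diag2_coord 1 x).
Proof. by []. Qed.

Lemma diag2P (x y : diag2 F) : diag2_coord 0 x = diag2_coord 0 y ->
  diag2_coord 1 x = diag2_coord 1 y -> x = y.
Proof.
case: x y => [x dx] [y dy]; rewrite /diag2_coord /= => e0 e1.
apply: val_inj; apply/matrixP => i j /=.
have /is_diag_mxP x0 := dx; have /is_diag_mxP y0 := dy.
have I2 (k : 'I_2) : k = 0 \/ k = 1.
  by case: k => -[|[|//]] k; [left|right]; apply: val_inj.
by case: (I2 i) (I2 j) => -> [] -> //; rewrite x0 // y0.
Qed.

Fact diag2_pair_subproof (u v : F) :
  diag_mx (\row_(i < 2) if i == 0 then u else v) \in @diag2_pred F.
Proof. exact: diag_mx_is_diag. Qed.

Definition diag2_pair u v : diag2 F := Diag2 (diag2_pair_subproof u v).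

Lemma diag2_pair0 u v : diag2_coord 0 (diag2_pair u v) = u.
Proof. by rewrite /diag2_coord !mxE. Qed.

Lemma diag2_pair1 u v : diag2_coord 1 (diag2_pair u v) = v.
Proof. by rewrite /diag2_coord !mxE. Qed.

End Diagonal.

Definition nword_cons (i : nat) (w : seq nat) : nword := exist _ (i :: w) isT.

Section D2.
Variables (F : fieldType) (alpha : F).
Hypothesis alpha_neq0 : alpha != 0.

(** The polarization of the Cayley-Hamilton identity
    x^2 - t(x) x + (t(x)^2 - t(x^2)) / 2 = 0 for t = tr / alpha, simplified by
    means of the commutativity of diagonal matrices. *)
Definition polar_CH : trfree F :=
  2 *: << trmon_of [::] [:: 0; 1]%N >>
  - alpha^-1 *: << trmon_of [:: nword_cons 0 [::]] [:: 1%N] >>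
  - alpha^-1 *: << trmon_of [:: nword_cons 1 [::]] [:: 0%N] >>
  + alpha^-2 *: << trmon_of [:: nword_cons 0 [::]; nword_cons 1 [::]] [::] >>
  - alpha^-1 *: << trmon_of [:: nword_cons 0 [:: 1%N]] [::] >>.

Lemma treval_polar_CH (A : traceAlg F) (a : nat -> A) :
  treval a polar_CH = 2 *: (a 0%N * a 1%N) - (alpha^-1 * tr (a 0%N)) *: a 1%N
    - (alpha^-1 * tr (a 1%N)) *: a 0%N
    + (alpha^-2 * (tr (a 0%N) * tr (a 1%N)) - alpha^-1 * tr (a 0%N * a 1%N))%:A.
Proof.
have tL (c d e : F) (k1 k2 k3 k4 k5 : trmon) :
    treval a (c *: << k1 >> - d *: << k2 >> - d *: << k3 >> + e *: << k4 >>
      - d *: << k5 >>) =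
    c *: mon_eval a k1 - d *: mon_eval a k2 - d *: mon_eval a k3
      + e *: mon_eval a k4 - d *: mon_eval a k5.
  have tB u v : treval a (u - v) = treval a u - treval a v by exact: linearB.
  have tZ b u : treval a (b *: u) = b *: treval a u by exact: linearZ_LR.
  rewrite -!treval_mon.
  by rewrite tB (linearD (treval a)) /= !tB !tZ.
rewrite /polar_CH tL.
rewrite !mon_eval_trmon_of /weval.
rewrite !(big_cons, big_nil) /=.
rewrite !mulr1 !scale1r.
by rewrite !scalerA scalerBl addrA.
Qed.

Lemma polar_CH_D2 : trace_ids (D2t alpha) polar_CH.
Proof.
move=> a; rewrite treval_polar_CH !diag2_trE.
by apply: diag2P;
  rewrite !(linearD, linearN, linearZ_LR) /= !rmorphM rmorph1 rmorph0 /=;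
  field.
Qed.

(** The elements f S are dual to the points b T. *)
Lemma codim_D2_ge n : (2 ^ n <= codim (D2t alpha) n)%N.
Proof.
have <- : #|{set 'I_n}| = (2 ^ n)%N.
  by rewrite -cardsT -powersetT card_powerset cardsT card_ord.
pose letters (S : {set 'I_n}) := map val (enum S).
pose f (S : {set 'I_n}) : trfree F :=
  << trmon_of [seq nword_cons i [::] | i <- letters (~: S)] (letters S) >>.
pose b (S : {set 'I_n}) (i : nat) : D2t alpha :=
  if i \in letters S then diag2_pair 1 (- 1) else diag2_pair 0 alpha^-1.
have memE (S : {set 'I_n}) (i : 'I_n) : (val i \in letters S) = (i \in S).
  by rewrite mem_map ?mem_enum //; exact: val_inj.
apply: (@codim_ge _ (D2t alpha) n _ (fun i => f (enum_val i))
  (fun i => b (enum_val i)) (diag2_coord 0)) => [i k|i j].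
  rewrite msuppU oner_eq0 in_fset1 => /eqP ->; apply/multilinear_trmon_of.
  set S := enum_val i; rewrite -val_enum_ord.
  have -> r : flatten (map val [seq nword_cons i [::] | i <- r]) = r.
    by rewrite -map_comp; elim: r => //= x r ->.
  rewrite -map_cat perm_map // uniq_perm ?enum_uniq //.
    rewrite cat_uniq !enum_uniq andbT /=; apply/hasPn => x.
    by rewrite !mem_enum inE negbK.
  by move=> x; rewrite mem_cat !mem_enum inE orNb.
have -> : (i == j) = (enum_val i == enum_val j).
  by rewrite (inj_eq enum_val_inj).
move: (enum_val i) (enum_val j) => S T {i j}.
rewrite treval_mon mon_eval_trmon_of big_map linearZ_LR /=.
rewrite /letters big_map -/(letters S).
rewrite /weval rmorph_prod /= !big_map !big_enum /=.
have trE i : tr (b T i) = (i \notin letters T)%:R.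
  rewrite diag2_trE /b; case: ifP => _; rewrite diag2_pair0 diag2_pair1.
    by rewrite subrr mulr0.
  by rewrite add0r divff.
have coordE i : diag2_coord 0 (b T i) = (i \in letters T)%:R.
  by rewrite /b; case: ifP => _; rewrite diag2_pair0.
under eq_bigr => i _ do rewrite /weval big_cons big_nil mulr1 trE memE.
under [X in _ * X]eq_bigr => i _ do rewrite coordE memE.
have [<-|ST] := eqVneq S T.
  by rewrite !big1 ?mulr1 // => i; rewrite ?inE => ->.
(* If S <> T, some trace or some letter evaluates to 0. *)
have [TS|/subsetPn[i iT iS]] := boolP (T \subset S); last first.
  rewrite [X in X * _](bigD1 i) ?inE //=.
  by rewrite iT !mul0r.
have /subsetPn[i iS iT] : ~~ (S \subset T).
  by apply: contra ST => ST'; rewrite finset.eqEsubset ST' TS.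
by rewrite [X in _ * X](bigD1 i) //= (negPf iT) mul0r mulr0.
Qed.

End D2.

(** * Proper subvarieties *)

Lemma poly_eq0_of_square_multiples (F : fieldType)
    (F0 : [pchar F] =i pred0) (c : F) (P : {poly F}) :
  c != 0 -> (forall n : nat, P.[n.+1%:R ^+ 2 * c] = 0) -> P = 0.
Proof.
move=> c0 Pr; apply: (@roots_geq_poly_eq0 _ P
  [seq n.+1%:R ^+ 2 * c | n <- iota 0 (size P)]).
- by apply/allP => _ /mapP[n _ ->]; rewrite rootE Pr.
- rewrite map_inj_uniq ?iota_uniq // => m n /(mulIf c0).
  have inj (i j : nat) : (i <= j)%N -> i%:R = j%:R :> F -> i = j.
    move=> ij /esym/eqP.
    rewrite -subr_eq0 -natrB // ((pcharf0P F).1 F0) subn_eq0 => ji.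
    by apply/eqP; rewrite eqn_leq ij.
  rewrite -!natrX; have [le|le] := leqP m n.
    move=> /inj; rewrite leq_exp2r // => /(_ le)/eqP.
    by rewrite eqn_exp2r // => /eqP[].
  move=> /esym/inj; rewrite leq_exp2r // => /(_ (ltnW le))/eqP.
  by rewrite eqn_exp2r // => /eqP[].
- by rewrite size_map size_iota.
Qed.

Section Subvarieties.
Variables (F : fieldType) (F0 : [pchar F] =i pred0) (alpha : F).
Hypothesis alpha_neq0 : alpha != 0.

Let nat_neq0 n : n.+1%:R != 0 :> F.
Proof. by rewrite ((pcharf0P F).1 F0). Qed.

(** B contains a form of D_2, and forms over an infinite field satisfy the same
    identities. *)
Lemma trace_ids_sub_D2 (B : traceAlg F) (z : B) (c : F) :
  c != 0 -> z * z = c%:A -> tr z = 0 -> tr (1 : B) = 2 * alpha ->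
  (trace_ids B `<=` trace_ids (D2t alpha))%classic.
Proof.
move=> c0 zz z0 t1 f fB a.
have two0 : (2 : F) != 0 := nat_neq0 1.
(* A diagonal matrix is p + q diag(1, -1). *)
pose u i := diag2_coord 0 (a i); pose v i := diag2_coord 1 (a i).
pose p i := (u i + v i) / 2; pose q i := (u i - v i) / 2.
have [P [Q PQ]] := treval_quadratic (2 * alpha) p q f.
have PQ0 n : P.[n.+1%:R ^+ 2 * c] = 0 /\ Q.[n.+1%:R ^+ 2 * c] = 0.
  set e := _ * c.
  have e0 : e != 0 by rewrite mulf_neq0 // expf_neq0.
  have ze : (n.+1%:R *: z) * (n.+1%:R *: z) = e%:A.
    by rewrite -scalerAl -scalerAr zz !scalerA /e expr2.
  have ze0 : tr (n.+1%:R *: z) = 0 by rewrite linearZ /= z0 mulr0.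
  have := PQ B _ _ ze ze0 t1; rewrite fB => PQB.
  have P0 : P.[e] = 0.
    have := congr1 tr PQB.
    rewrite linear0 linearD !linearZ_LR /= z0 t1 !mulr0 addr0.
    move=> /esym/eqP; rewrite !mulf_eq0 (negPf two0) (negPf alpha_neq0) !orbF.
    by move/eqP.
  split=> //; apply/eqP; apply: contraTT isT => Q0.
  move: PQB; rewrite P0 scale0r add0r => /esym/eqP.
  rewrite scaler_eq0 (negPf Q0) /= => /eqP zn0; move: ze.
  rewrite zn0 mul0r => /(congr1 tr)/esym/eqP; rewrite linear0 linearZ_LR /= t1.
  by rewrite (negPf (mulf_neq0 e0 (mulf_neq0 two0 alpha_neq0))).
have P0 : P = 0.
  by apply: (poly_eq0_of_square_multiples F0 c0) => n; case: (PQ0 n).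
have Q0 : Q = 0.
  by apply: (poly_eq0_of_square_multiples F0 c0) => n; case: (PQ0 n).
pose w : D2t alpha := diag2_pair 1 (- 1).
have -> : a = (fun i => (p i)%:A + q i *: w).
  apply/funext => i; apply: diag2P; rewrite linearD !linearZ_LR /= rmorph1.
    by rewrite diag2_pair0 /p /q -/(u i); field.
  by rewrite diag2_pair1 /p /q -/(v i); field.
rewrite (PQ (D2t alpha) w 1) ?P0 ?Q0 ?horner0 ?scale0r ?addr0 //.
- apply: diag2P; rewrite rmorphM ?linearZ_LR /= rmorph1.
    by rewrite diag2_pair0 !mulr1.
  by rewrite diag2_pair1 mulrNN !mulr1.
- by rewrite diag2_trE diag2_pair0 diag2_pair1 subrr mulr0.
- by rewrite diag2_trE !rmorph1; ring.
Qed.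

(** Each case provides a linear form for [codim_square_zero]: tr / alpha when all
    elements are scalar, and tr / (2 alpha) when the kernel of the trace has zero
    multiplication. *)
Lemma codim_subvariety (B : traceAlg F) n :
  trace_var (D2t alpha) B ->
  ~ (trace_ids B `<=` trace_ids (D2t alpha))%classic ->
  (codim B n <= n.+1)%N.
Proof.
move=> BV BN; have two0 : (2 : F) != 0 := nat_neq0 1.
have CH (x y : B) : 2 *: (x * y) - (alpha^-1 * tr x) *: y
    - (alpha^-1 * tr y) *: x
    + (alpha^-2 * (tr x * tr y) - alpha^-1 * tr (x * y))%:A = 0.
  have := BV _ (polar_CH_D2 alpha_neq0) (fun i => if i is 0%N then x else y).
  by rewrite treval_polar_CH.
have [t1|t1] := eqVneq (tr (1 : B)) (2 * alpha); last first.
  have xE (x : B) : x - (alpha^-1 * tr x)%:A = 0.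
    have := CH x 1; rewrite !mulr1 expr2 invfM mulrACA => CHx.
    have : (2 - alpha^-1 * tr (1 : B)) *: (x - (alpha^-1 * tr x)%:A) = 0.
      rewrite -[RHS]CHx.
      move: (alpha^-1 * tr x) (alpha^-1 * tr 1) => b a.
      rewrite scalerBl !scalerBr !scalerA [in RHS]scalerBl.
      have -> : (2 * b)%:A = b%:A + b%:A :> B.
        by rewrite mulr_natl mulr2n scalerDl.
      rewrite [- (b%:A + _)]opprD opprB -!addrA [b * a]mulrC.
      by congr (_ + (_ + _)); rewrite addrC -addrA addrCA.
    move/eqP; rewrite scaler_eq0 subr_eq0 => /orP[/eqP e|/eqP//].
    by case/eqP: t1; rewrite e mulrAC mulVf ?mul1r.
  by apply: (@codim_square_zero _ _ (fun x => alpha^-1 * tr x)) => x *;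
    rewrite !xE ?linear0 ?mul0r.
have sq0 (z : B) : tr z = 0 -> z * z = 0.
  move=> z0; have := CH z z; rewrite z0 !(mulr0, scale0r, subr0) sub0r.
  (* The identity makes z^2 scalar; this scalar is 0 as BN holds. *)
  set d := tr _ => zz.
  have {}zz : z * z = (d / (2 * alpha))%:A.
    move/eqP: zz; rewrite scaleNr subr_eq0 => /eqP /(congr1 ( *:%R 2^-1)).
    rewrite !scalerA mulVf // scale1r => ->; congr (_ *: _).
    by rewrite invfM mulrA mulrC.
  have [d0|d0] := eqVneq d 0; first by rewrite zz d0 mul0r scale0r.
  case: BN; apply: (trace_ids_sub_D2 _ zz z0 t1).
  by rewrite mulf_neq0 // invr_eq0 mulf_neq0.
(* From (x + y)^2 = 0, tr(xy) = 0; then the identity gives xy = 0. *)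
have mul0 (x y : B) : tr x = 0 -> tr y = 0 -> x * y = 0.
  move=> x0 y0; have := CH x y; rewrite x0 y0 !(mulr0, scale0r, subr0) sub0r.
  have := sq0 (x + y); rewrite linearD x0 y0 addr0 => /(_ erefl).
  rewrite mulrDl !mulrDr !sq0 // add0r addr0 => xy0.
  have : tr (x * y + y * x) = 0 by rewrite xy0 linear0.
  rewrite linearD /= [tr (y * x)]trMC -mulr2n -[tr _ *+ 2]mulr_natl => /eqP.
  rewrite mulf_eq0 (negPf two0) /= => /eqP ->.
  rewrite mulr0 oppr0 scale0r addr0 => /eqP.
  by rewrite scaler_eq0 (negPf two0) => /eqP.
have tr0 (x : B) : tr (x - (tr x / (2 * alpha))%:A) = 0.
  by rewrite linearB linearZ_LR /= t1 divfK ?subrr // mulf_neq0.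
by apply: (@codim_square_zero _ _ (fun x => tr x / (2 * alpha))) => // x y;
  exact: mul0.
Qed.

End Subvarieties.

Theorem theorem12 (F : fieldType) (F0 : [pchar F] =i pred0) (R : realType)
  (alpha : F) (alpha_neq0 : alpha != 0) :
  almost_poly_growth R (trace_var (D2t alpha)).
Proof.
split=> [A genA|A [AV [B [BV BA]]]].
  exists 1, 2; split; rewrite ?ltr01 ?ltr1n // => n _.
  have AD : trace_ids A = trace_ids (D2t alpha).
    rewrite eqEsubset; split.
      exact: ((genA _).2 (fun f => id)).
    exact: ((genA A).1 (fun f => id)).
  rewrite mul1r -natrX ler_nat.
  by rewrite /codim AD; exact: codim_D2_ge.
exists ('X + 1) => n; rewrite !hornerE natr1 ler_nat.
apply: (codim_subvariety F0 alpha_neq0) => [|AD]; first exact: AV.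
by apply: BA => f /AD; exact: BV.
Qed.
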